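(* Let $(X,d,p)$ be a metric space with a marked point $p$. If all pretangent spaces $\Omega_{p,\tilde r}^{X}$ to $X$ at $p$ (for all normalizing sequences $\tilde r$) are complete geodesic spaces of nonnegative curvature in the sense of Aleksandrov, then $X$ is midpoint convex at $p$ and $$\liminf_{w,x,y,z\to p}A_{2}(w,x,y,z)\ge 0,$$ where $A_2:X^4\to\mathbb R$ is defined by $$A_{2}(w,x,y,z):= \frac{d^{2}(w,x)+d^{2}(w,y)+d^{2}(w,z)-\frac{1}{3}\bigl(d^{2}(x,y)+d^{2}(y,z)+d^{2}(z,x)\bigr)}{\bigl(\max\{d(w,p),d(x,p),d(y,p),d(z,p)\}\bigr)^{2}}$$ for $(w,x,y,z)\neq(p,p,p,p)$ and $A_2(p,p,p,p):=0$.
   Context: Pretangent spaces. Let $(X,d,p)$ be a metric space with marked point $p$. A normalizing sequence is a sequence $\tilde r=\{r_n\}_{n\in\mathbb N}$ of positive reals with $r_n\to 0$. Let $\tilde X$ be the set of all sequences of points of $X$. Two sequences $\tilde x=\{x_n\},\tilde y=\{y_n\}\in\tilde X$ are mutually stable with respect to $\tilde r$ if the finite limit $\tilde d_{\tilde r}(\tilde x,\tilde y):=\lim_{n\to\infty} d(x_n,y_n)/r_n$ exists. A family $\tilde F\subseteq\tilde X$ is self-stable if any two of its elements are mutually stable; it is maximal self-stable if moreover for every $\tilde z\in\tilde X\setminus\tilde F$ there is $\tilde x\in\tilde F$ such that $\tilde x,\tilde z$ are not mutually stable. Let $\tilde X_{p,\tilde r}$ denote a maximal self-stable family (with respect to $\tilde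 r$) containing the constant sequence $\tilde p=(p,p,\dots)$. Then $(\tilde X_{p,\tilde r},\tilde d_{\tilde r})$ is a pseudometric space; the metric space $(\Omega_{p,\tilde r}^{X},\rho)$ obtained from it by identifying $\tilde x,\tilde y$ whenever $\tilde d_{\tilde r}(\tilde x,\tilde y)=0$, with $\rho$ induced by $\tilde d_{\tilde r}$, is called a pretangent space to $X$ at $p$ with respect to $\tilde r$. (There may be several pretangent spaces for one $\tilde r$, depending on the choice of $\tilde X_{p,\tilde r}$.) Midpoint convexity at $p$. $X$ is midpoint convex at $p$ if for any two sequences $\tilde x=\{x_n\}$, $\tilde y=\{y_n\}$ in $X$ converging to $p$ there is a sequence $\tilde z=\{z_n\}$ in $X$ (called an infinitesimal midpoint of $\tilde x,\tilde y$) such that, with $\delta_p(x,y):=\max\{d(x,p),d(y,p)\}$, $$\lim_{n\to\infty}\frac{|d(x_n,z_n)-\frac12 d(x_n,y_n)|}{\delta_p(x_n,y_n)}=\lim_{n\to\infty}\frac{|d(y_n,z_n)-\frac12 d(x_n,y_n)|}{\delta_p(x_n,y_n)}=0,$$ where, when $x_n=y_n=p$, the quotients are understood as $0$ if $z_n=p$ and as $+\infty$ if $z_n\ne p$. Nonnegative curvature in the sense of Aleksandrov has its usual meaning for geodesic metric spaces, defined via Euclidean comparison triangles (geodesic triangles are not thinner than their comparison triangles; for complete geodesic spaces the local and global versions agree). *)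

(* Defs.v *)
From HB Require Import structures.
From mathcomp Require Import all_boot all_order all_algebra.
From mathcomp Require Import generic_quotient.
From mathcomp Require Import all_classical all_reals all_analysis.

Set Implicit Arguments.
Unset Strict Implicit.
Unset Printing Implicit Defensive.

Import Order.TTheory GRing.Theory Num.Theory.
Import numFieldNormedType.Exports.

Local Open Scope classical_set_scope.
Local Open Scope ring_scope.
Local Open Scope quotient_scope.

Section PretangentSpaces.
Context {R : realType} {X : metricType R}.
Implicit Types (r : nat -> R) (F : set (nat -> X)) (x y z : nat -> X) (p : X).

Definition normalizing r := (forall n, 0 < r n) /\ r @ \oo --> 0.

Definition mutually_stable r x y := cvgn (fun n => mdist (x n) (y n) / r n).

Definition dtilde r x y : R := limn (fun n => mdist (x n) (y n) / r n).

Definition self_stable r F := forall x y, F x -> F y -> mutually_stable r x y.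

Definition maximal_self_stable r F := self_stable r F /\
  forall z, ~ F z -> exists2 x, F x & ~ mutually_stable r x z.

Definition pretangent_family p r F := maximal_self_stable r F /\ F (fun=> p).

Lemma dtildexx r x : dtilde r x x = 0.
Proof. by rewrite /dtilde; under eq_fun do rewrite mdistxx mul0r; exact: lim_cst. Qed.

Lemma dtildeC r x y : dtilde r x y = dtilde r y x.
Proof. by rewrite /dtilde; under eq_fun do rewrite metric_sym. Qed.

Lemma dtilde_ge0 r x y : normalizing r -> mutually_stable r x y ->
  0 <= dtilde r x y.
Proof.
move=> [r0 _] xy; apply: limr_ge => //; near=> n.
by rewrite divr_ge0 ?mdist_ge0// ltW.
Unshelve. all: by end_near. Qed.

Lemma dtilde_triangle r x y z : normalizing r -> mutually_stable r x y ->
  mutually_stable r y z -> mutually_stable r x z ->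
  dtilde r x z <= dtilde r x y + dtilde r y z.
Proof.
move=> [r0 _] xy yz xz; rewrite /dtilde -limD//; apply: ler_lim => //.
  exact: is_cvgD.
near=> n; rewrite /= -mulrDl ler_pM2r ?invr_gt0//; exact: metric_triangle.
Unshelve. all: by end_near. Qed.

End PretangentSpaces.

Section PretangentSpace.
Context {R : realType} {X : metricType R} (p : X) (r : nat -> R).
Context (F : set (nat -> X)).
Hypotheses (hr : normalizing r) (hF : pretangent_family p r F).

Definition indist (x y : F) : bool := dtilde r (val x) (val y) == 0.

Let st (x y : F) : mutually_stable r (val x) (val y).
Proof. by case: hF => -[h _] _; apply: h; exact: set_valP. Qed.

Let tri (y x z : F) : dtilde r (val x) (val z) <=
  dtilde r (val x) (val y) + dtilde r (val y) (val z).
Proof. exact: (dtilde_triangle hr (@st x y) (@st y z) (@st x z)). Qed.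

Let indist_refl : reflexive indist.
Proof. by move=> x; rewrite /indist dtildexx. Qed.

Let indist_sym : symmetric indist.
Proof. by move=> x y; rewrite /indist dtildeC. Qed.

Let indist_trans : transitive indist.
Proof.
move=> y x z /eqP xy /eqP yz; rewrite /indist eq_le dtilde_ge0// andbT.
by have := tri y x z; rewrite xy yz addr0.
Qed.

Canonical indist_equiv := EquivRel indist indist_refl indist_sym indist_trans.

Definition pretangent : Type := {eq_quot indist_equiv}.

HB.instance Definition _ := Choice.on pretangent.
HB.instance Definition _ := EqQuotient.on pretangent.

Definition rho (a b : pretangent) : R :=
  dtilde r (val (repr a)) (val (repr b)).

Let rho_xx a : rho a a = 0. Proof. exact: dtildexx. Qed.

Let rho_positivity a b : rho a b = 0 -> a = b.
Proof.
move=> /eqP ab; rewrite -[a]reprK -[b]reprK.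
exact/eqmodP.
Qed.

Let rho_sym a b : rho a b = rho b a. Proof. exact: dtildeC. Qed.

Let rho_triangle b a c : rho a c <= rho a b + rho b c.
Proof. exact: tri. Qed.

HB.instance Definition _ := isMetric.Build R pretangent
  rho_xx rho_positivity rho_sym rho_triangle.

Lemma mdist_pretangent (x y : F) :
  mdist (\pi_pretangent x : pretangent) (\pi_pretangent y)
  = dtilde r (val x) (val y).
Proof.
have h (z : F) : dtilde r (val (repr (\pi_pretangent z))) (val z) = 0.
  apply/eqP; rewrite -/(indist _ _); apply/eqmodP; exact: reprK.
apply/eqP; rewrite eq_le; apply/andP; split.
  apply: (le_trans (tri x _ _)); rewrite h add0r.
  by apply: (le_trans (tri y _ _)); rewrite (dtildeC _ (val y)) h addr0.
apply: (le_trans (tri (repr (\pi_pretangent x)) _ _)).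
rewrite dtildeC h add0r.
by apply: (le_trans (tri (repr (\pi_pretangent y)) _ _)); rewrite h addr0.
Qed.

End PretangentSpace.

Section AleksandrovCurvature.
Context {R : realType}.

Definition complete_space (T : metricType R) :=
  forall u : nat -> T, cauchy (u @ \oo) -> exists l : T, u @ \oo --> l.

Definition geodesic (T : metricType R) (x y : T) (g : R -> T) :=
  [/\ g 0 = x, g (mdist x y) = y &
      {in `[0, mdist x y] &, forall s t, mdist (g s) (g t) = `|s - t|}].

Definition geodesic_space (T : metricType R) :=
  forall x y : T, exists g, geodesic x y g.

(* The library norm on R * R is the sup norm, hence this Euclidean distance. *)
Definition edist2 (a b : R * R) : R :=
  Num.sqrt ((a.1 - b.1) ^+ 2 + (a.2 - b.2) ^+ 2).

Definition comparison_triangle (T : metricType R) (x y z : T)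
    (x' y' z' : R * R) :=
  [/\ edist2 x' y' = mdist x y, edist2 x' z' = mdist x z &
      edist2 y' z' = mdist y z].

(* For u on a geodesic from x to y, the two equations say that u' is the point
   of the segment [x', y'] at distance d(x, u) from x'. *)
Definition comparison_point (T : metricType R) (x y : T) (x' y' : R * R)
    (u : T) (u' : R * R) :=
  edist2 x' u' = mdist x u /\ edist2 u' y' = mdist u y.

(* The vertices being arbitrary, the points u, v taken on the two sides issuing
   from x cover every pair of sides of a geodesic triangle; two points of one
   side are as far apart as their comparison points. *)
Definition nonneg_curved (T : metricType R) :=
  forall (x y z : T) (f g h : R -> T),
    geodesic x y f -> geodesic x z g -> geodesic y z h ->
  forall x' y' z' : R * R, comparison_triangle x y z x' y' z' ->
  forall s t, s \in `[0, mdist x y] -> t \in `[0, mdist x z] ->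
  forall u' v' : R * R,
    comparison_point x y x' y' (f s) u' ->
    comparison_point x z x' z' (g t) v' ->
  edist2 u' v' <= mdist (f s) (g t).

End AleksandrovCurvature.

Section InfinitesimalConditions.
Context {R : realType} {X : metricType R} (p : X).

Definition delta (x y : X) : R := Num.max (mdist x p) (mdist y p).

(* [midpoint_defect a x y z] is the quotient |d(a, z) - d(x, y) / 2| / delta,
   to be used with a = x and a = y. *)
Definition midpoint_defect (a x y z : X) : \bar R :=
  if (x == p) && (y == p) then (if z == p then 0%E else +oo%E)
  else (`|mdist a z - mdist x y / 2| / delta x y)%:E.

Definition infinitesimal_midpoint (x y z : nat -> X) :=
  midpoint_defect (x n) (x n) (y n) (z n) @[n --> \oo] --> 0%E /\
  midpoint_defect (y n) (x n) (y n) (z n) @[n --> \oo] --> 0%E.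

Definition midpoint_convex_at :=
  forall x y : nat -> X, x @ \oo --> p -> y @ \oo --> p ->
  exists z : nat -> X, infinitesimal_midpoint x y z.

Definition A2 (w x y z : X) : R :=
  if (w, x, y, z) == (p, p, p, p) then 0 else
  (mdist w x ^+ 2 + mdist w y ^+ 2 + mdist w z ^+ 2
   - 1 / 3 * (mdist x y ^+ 2 + mdist y z ^+ 2 + mdist z x ^+ 2))
  / Num.max (Num.max (Num.max (mdist w p) (mdist x p)) (mdist y p))
      (mdist z p) ^+ 2.

End InfinitesimalConditions.

(* Main.v *)
Require Import Defs.
From HB Require Import structures.
From mathcomp Require Import all_boot all_order all_algebra.
From mathcomp Require Import all_classical all_reals all_analysis.
From mathcomp Require Import ring lra.
Set Implicit Arguments.
Unset Strict Implicit.
Unset Printing Implicit Defensive.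

Import Order.TTheory GRing.Theory Num.Theory.
Import numFieldNormedType.Exports.
Local Open Scope classical_set_scope.
Local Open Scope ring_scope.

(** A violation of either conclusion along a sequence of configurations
   shrinking to [p] can be blown up: after rescaling by the largest distance to
   [p] and passing to a subsequence along which all rescaled distances converge,
   the configuration becomes a configuration of points of some pretangent space
   (a self-stable family extends to a maximal one by Zorn), which contradicts
   the existence of midpoints there, respectively the inequality
     d(x,y)^2 + d(y,z)^2 + d(z,x)^2 <= 3 (d(w,x)^2 + d(w,y)^2 + d(w,z)^2)
   valid in nonnegative curvature.

   For this inequality write <u,v>_q for the scalar product at [q] in a
   comparison triangle; it says |x|^2 + |y|^2 + |z|^2 + 2 (<x,y> + <y,z> + <z,x>)
   >= 0 at w, and the comparison hypothesis says <su,tv> <= st <u,v> for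
   s, t in [0, 1].  By continuity w may be replaced by a point q inside a geodesic
   from w to x, so that there is a point a opposite to x, for which
   <u,x> + <u,a> >= 0.  After shrinking all points towards q, it remains to
   bound |y|^2 + |z|^2 + |a|^2 + 2 (<y,z> - <y,a> - <z,a>) from below.  The
   triangle inequality d(y,z) <= d(y,a/2) + d(a/2,z) bounds the same expression
   with <y,a>, <z,a> replaced by 2<y,a/2>, 2<z,a/2>, and monotonicity of the
   rescaled scalar products makes the difference negligible at small scales. *)

(** * Plane comparison triangles, pieces of geodesics, scalar products *)

Lemma sqr_edist2 (R : realType) (a b : R * R) :
  edist2 a b ^+ 2 = (a.1 - b.1) ^+ 2 + (a.2 - b.2) ^+ 2.
Proof. by rewrite sqr_sqrtr// addr_ge0// sqr_ge0. Qed.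

Lemma edist2_eqP (R : realType) (a b : R * R) (c : R) : 0 <= c ->
  (a.1 - b.1) ^+ 2 + (a.2 - b.2) ^+ 2 = c ^+ 2 -> edist2 a b = c.
Proof. by move=> c0 e; rewrite /edist2 e sqrtr_sqr ger0_norm. Qed.

(** With [x'] at the origin and [y'] on the first axis, the law of cosines fixes the first
    coordinate of [z'], and the triangle inequalities bound it by [b] in absolute value, so that the
    second coordinate is a real square root. *)
Lemma comparison_triangle_exists (R : realType) (T : metricType R) (x y z : T) :
  exists y' z', comparison_triangle x y z (0, 0) y' z'.
Proof.
set a := mdist x y; set b := mdist x z; set c := mdist y z.
have a0 : 0 <= a by exact: mdist_ge0.
have b0 : 0 <= b by exact: mdist_ge0.
have c0 : 0 <= c by exact: mdist_ge0.
have tc : c <= a + b by rewrite /a (metric_sym x y); exact: metric_triangle.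
have tb : b <= a + c by exact: metric_triangle.
have ta : a <= b + c by rewrite /c (metric_sym y z); exact: metric_triangle.
(* For [a = 0] the law of cosines cannot be solved for [k]; here [b = c] and the triangle collapses
   to a segment. *)
have [az|an0] := eqVneq a 0.
  have bc : c = b by apply/eqP; rewrite eq_le; apply/andP; split; lra.
  exists (0, 0), (b, 0); split; apply: edist2_eqP => //=.
  - by rewrite -/a az; ring.
  - by rewrite -/b; ring.
  - by rewrite -/c bc; ring.
have ap : 0 < a by rewrite lt_def an0.
pose k := (a ^+ 2 + b ^+ 2 - c ^+ 2) / (2 * a).
have ka : 2 * a * k = a ^+ 2 + b ^+ 2 - c ^+ 2 by rewrite /k; field.
have kb : 0 <= b ^+ 2 - k ^+ 2.
  have k1 : k <= b.
    rewrite -(ler_pM2l (_ : 0 < 2 * a)) ?mulr_gt0// ka.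
    rewrite -subr_ge0 [leRHS](_ : _ = (c - (a - b)) * (c + (a - b))); last by ring.
    by apply: mulr_ge0; lra.
  have k2 : - b <= k.
    rewrite -(ler_pM2l (_ : 0 < 2 * a)) ?mulr_gt0// ka.
    rewrite -subr_ge0 [leRHS](_ : _ = ((a + b) - c) * ((a + b) + c)); last by ring.
    by apply: mulr_ge0; lra.
  by rewrite subr_sqr; apply: mulr_ge0; lra.
exists (a, 0), (k, Num.sqrt (b ^+ 2 - k ^+ 2)); split; apply: edist2_eqP => //=.
- by rewrite -/a; ring.
- by rewrite !sub0r !sqrrN sqr_sqrtr//; rewrite -/b; ring.
- rewrite sub0r sqrrN sqr_sqrtr// -/c.
  by transitivity (a ^+ 2 + b ^+ 2 - 2 * a * k); [ring | rewrite ka; ring].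
Qed.

Lemma geodesic_dist0 (R : realType) (T : metricType R) (x y : T) (f : R -> T) s :
  geodesic x y f -> 0 <= s <= mdist x y -> mdist x (f s) = s.
Proof.
move=> [f0 _ fd] /andP[s0 sd].
rewrite -{1}f0 fd ?in_itv/= ?lexx ?mdist_ge0 ?s0//.
by rewrite sub0r normrN ger0_norm.
Qed.

Lemma geodesic_dist1 (R : realType) (T : metricType R) (x y : T) (f : R -> T) s :
  geodesic x y f -> 0 <= s <= mdist x y -> mdist (f s) y = mdist x y - s.
Proof.
move=> [_ f1 fd] /andP[s0 sd].
rewrite -{1}f1 fd ?in_itv/= ?lexx ?mdist_ge0 ?s0//.
by rewrite distrC ger0_norm// subr_ge0.
Qed.

Lemma geodesic_shift (R : realType) (T : metricType R) (x y : T) (f : R -> T) s t :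
  geodesic x y f -> 0 <= s -> s <= t -> t <= mdist x y ->
  geodesic (f s) (f t) (fun u => f (s + u)).
Proof.
move=> [f0 f1 fd] s0 st td.
have d : mdist (f s) (f t) = t - s.
  rewrite fd ?in_itv/=; last 2 first.
  - by apply/andP; split; lra.
  - by apply/andP; split; lra.
  by rewrite distrC ger0_norm// subr_ge0.
split; rewrite ?addr0 ?d ?subrKC//.
move=> u v; rewrite !in_itv/= => /andP[u0 ut] /andP[v0 vt].
rewrite fd ?in_itv/=; last 2 first.
- by apply/andP; split; lra.
- by apply/andP; split; lra.
by congr `| _ |; ring.
Qed.

Lemma geodesic_reverse (R : realType) (T : metricType R) (x y : T) (f : R -> T) s t :
  geodesic x y f -> 0 <= s -> s <= t -> t <= mdist x y ->
  geodesic (f t) (f s) (fun u => f (t - u)).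
Proof.
move=> [f0 f1 fd] s0 st td.
have d : mdist (f t) (f s) = t - s.
  rewrite fd ?in_itv/=; last 2 first.
  - by apply/andP; split; lra.
  - by apply/andP; split; lra.
  by rewrite ger0_norm// subr_ge0.
split; rewrite ?subr0 ?d ?subKr//.
move=> u v; rewrite !in_itv/= => /andP[u0 ut] /andP[v0 vt].
rewrite fd ?in_itv/=; last 2 first.
- by apply/andP; split; lra.
- by apply/andP; split; lra.
by rewrite distrC; congr `| _ |; ring.
Qed.

Lemma geodesic_initial (R : realType) (T : metricType R) (x y : T) (f : R -> T) s :
  geodesic x y f -> 0 <= s <= mdist x y -> geodesic x (f s) f.
Proof.
move=> gf /andP[s0 sd]; have [f0 _ _] := gf.
have := geodesic_shift gf (lexx 0) s0 sd.
by rewrite f0 (_ : (fun u => f (0 + u)) = f)//; apply/funext => u; rewrite add0r.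
Qed.

(* Euclidean polarization: the scalar product of the vectors from [q] to [x]
   and from [q] to [y] in a comparison triangle. *)
Definition cprod (R : realType) (T : metricType R) (q x y : T) : R :=
  (mdist q x ^+ 2 + mdist q y ^+ 2 - mdist x y ^+ 2) / 2.

Lemma cprod_ge (R : realType) (T : metricType R) (q x y : T) :
  - (mdist q x * mdist q y) <= cprod q x y.
Proof.
have t : mdist x y <= mdist q x + mdist q y.
  by rewrite (metric_sym q x); exact: metric_triangle.
rewrite /cprod; have := mdist_ge0 x y; have := mdist_ge0 q x.
have := mdist_ge0 q y; nra.
Qed.

(** * The four-point inequality in nonnegative curvature *)

Section NonnegCurved.
Context (R : realType) (T : metricType R).
Hypotheses (gT : geodesic_space T) (cT : nonneg_curved T).
Implicit Types (w x y z q u : T) (f g : R -> T).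

(** The comparison points are [s y'] and [t z'], with [x'] at the origin. Distances from [x] are
    preserved, so a lower bound on the distance between the two points is an upper bound on their
    scalar product. *)
Lemma cprod_scale x y z f g s t :
  geodesic x y f -> geodesic x z g -> 0 <= s <= 1 -> 0 <= t <= 1 ->
  cprod x (f (s * mdist x y)) (g (t * mdist x z)) <= s * t * cprod x y z.
Proof.
move=> gf gg /andP[s0 s1] /andP[t0 t1].
have [h gh] := gT y z.
have [y' [z' cmp]] := comparison_triangle_exists x y z.
have [ea eb ec] := cmp.
set a := mdist x y in ea *; set b := mdist x z in eb *.
set c := mdist y z in ec.
have a0 : 0 <= a by exact: mdist_ge0.
have b0 : 0 <= b by exact: mdist_ge0.
have sa : 0 <= s * a <= a by rewrite mulr_ge0// ler_piMl.
have tb : 0 <= t * b <= b by rewrite mulr_ge0// ler_piMl.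
move: (congr1 (fun r => r ^+ 2) ea) (congr1 (fun r => r ^+ 2) eb)
  (congr1 (fun r => r ^+ 2) ec); rewrite !sqr_edist2 /= !sub0r !sqrrN => qa qb qc.
have sa' : s * a \in `[0, mdist x y] by rewrite in_itv.
have tb' : t * b \in `[0, mdist x z] by rewrite in_itv.
have /= := cT gf gg gh cmp sa' tb'.
move=> /(_ (s * y'.1, s * y'.2) (t * z'.1, t * z'.2)).
have ds := geodesic_dist0 gf sa.
have dt := geodesic_dist0 gg tb.
have c1 : comparison_point x y (0, 0) y' (f (s * a)) (s * y'.1, s * y'.2).
  split; rewrite ?ds ?(geodesic_dist1 gf)//; apply: edist2_eqP => /=.
  - by case/andP: sa.
  - by transitivity (s ^+ 2 * (y'.1 ^+ 2 + y'.2 ^+ 2)); [|rewrite qa]; ring.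
  - by rewrite subr_ge0; case/andP: sa.
  - rewrite -/a; transitivity ((1 - s) ^+ 2 * (y'.1 ^+ 2 + y'.2 ^+ 2)); [|rewrite qa]; ring.
have c2 : comparison_point x z (0, 0) z' (g (t * b)) (t * z'.1, t * z'.2).
  split; rewrite ?dt ?(geodesic_dist1 gg)//; apply: edist2_eqP => /=.
  - by case/andP: tb.
  - by transitivity (t ^+ 2 * (z'.1 ^+ 2 + z'.2 ^+ 2)); [|rewrite qb]; ring.
  - by rewrite subr_ge0; case/andP: tb.
  - rewrite -/b; transitivity ((1 - t) ^+ 2 * (z'.1 ^+ 2 + z'.2 ^+ 2)); [|rewrite qb]; ring.
move=> /(_ c1 c2) le.
have : edist2 (s * y'.1, s * y'.2) (t * z'.1, t * z'.2) ^+ 2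
    <= mdist (f (s * a)) (g (t * b)) ^+ 2.
  by rewrite ler_sqr ?nnegrE ?sqrtr_ge0 ?mdist_ge0.
rewrite sqr_edist2/= /cprod ds dt -/a -/b -/c -qa -qb -qc.
set D := mdist _ _ ^+ 2 => leD.
rewrite !exprMn -qa -qb; lra.
Qed.

(** The left side is the squared length of the Euclidean median; this is [cprod_scale] at [x] with
    parameters 1/2 and 1. *)
Lemma midpoint_dist x y u f : geodesic x y f ->
  mdist u x ^+ 2 / 2 + mdist u y ^+ 2 / 2 - mdist x y ^+ 2 / 4
    <= mdist u (f (mdist x y / 2)) ^+ 2.
Proof.
move=> gf; have [g gg] := gT x u.
have := @cprod_scale x y u f g 2^-1 1 gf gg.
rewrite mul1r; case: (gg) => _ -> _ => /(_ ltac:(by lra) ltac:(by lra)).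
have := @geodesic_dist0 _ _ _ _ _ (mdist x y / 2) gf.
have := mdist_ge0 x y => xy0 /(_ ltac:(by lra)).
rewrite /cprod (mulrC 2^-1) => ->.
rewrite (metric_sym u x) (metric_sym u y) (metric_sym u (f _)).
lra.
Qed.

Lemma four_point_interior w x y z f s : geodesic w x f -> 0 < s < mdist w x ->
  mdist x y ^+ 2 + mdist y z ^+ 2 + mdist z x ^+ 2 <=
  3 * (mdist (f s) x ^+ 2 + mdist (f s) y ^+ 2 + mdist (f s) z ^+ 2).
Proof.
move=> gf /andP[s0 sD]; set q := f s; set D := mdist w x.
have [_ f1 fd] := gf.
pose fx r := f (s + r); pose fa r := f (s - r).
have gx : geodesic q x fx.
  by rewrite -f1; apply: geodesic_shift gf _ _ _ => //; exact: ltW.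
have ga : geodesic q (f 0) fa.
  by apply: geodesic_reverse gf _ _ _ => //; exact: ltW.
have [fy gy] := gT q y; have [fz gz] := gT q z.
set L := mdist q x; have L0 : 0 < L.
  by rewrite /L (geodesic_dist1 gf) ?subr_gt0// !ltW.
have ds : mdist q (f 0) = s.
  by have [-> _ _] := gf; rewrite metric_sym (geodesic_dist0 gf)// !ltW.
set b := mdist q y; set c := mdist q z.
have b0 : 0 <= b by exact: mdist_ge0.
have c0 : 0 <= c by exact: mdist_ge0.
(* The bound [s / L] keeps [a_ t] on the part of the geodesic between [q] and [w], at the same
   distance [t * L] from [q] as [x_ t]. *)
pose t0 := Num.min 1 (s / L).
have t00 : 0 < t0 by rewrite lt_min ltr01 divr_gt0.
pose a_ t := fa (t * L); pose x_ t := fx (t * L).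
pose y_ t := fy (t * b); pose z_ t := fz (t * c).
have tle (t : R) : 0 < t <= t0 -> [/\ 0 < t, t <= 1 & t * L <= s].
  by rewrite le_min => /and3P[-> -> ?]; rewrite -ler_pdivlMr.
have da t : 0 < t <= t0 -> mdist q (a_ t) = t * L.
  move/tle=> [t1 _ t2]; rewrite (geodesic_dist0 ga)// ds t2 andbT.
  by rewrite mulr_ge0// ltW.
have dx t : 0 < t <= t0 -> mdist q (x_ t) = t * L.
  move/tle=> [t1 t2 _]; rewrite (geodesic_dist0 gx)//.
  by rewrite mulr_ge0 ?(ltW t1) ?(ltW L0)//= ler_piMl// ltW.
have dy t : 0 < t <= t0 -> mdist q (y_ t) = t * b.
  move/tle=> [t1 t2 _]; rewrite (geodesic_dist0 gy)//.
  by rewrite mulr_ge0 ?(ltW t1)//= ler_piMl.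
have dz t : 0 < t <= t0 -> mdist q (z_ t) = t * c.
  move/tle=> [t1 t2 _]; rewrite (geodesic_dist0 gz)//.
  by rewrite mulr_ge0 ?(ltW t1)//= ler_piMl.
(* As [q] is the midpoint of a geodesic from [a_ t] to [x_ t], this is [midpoint_dist] rewritten in
   scalar products. *)
have opp t u : 0 < t <= t0 -> 0 <= cprod q u (a_ t) + cprod q u (x_ t).
  move=> tt; have [t1 t2 t3] := tle _ tt.
  have tL : t * L <= L by rewrite ler_piMl// ltW.
  have tL0 : 0 < t * L by rewrite mulr_gt0.
  have LD : L = D - s by rewrite /L (geodesic_dist1 gf)// !ltW.
  have gax : geodesic (a_ t) (x_ t) (fun r => f (s - t * L + r)).
    apply: geodesic_shift gf _ _ _; rewrite -?/D; lra.
  have dax : mdist (a_ t) (x_ t) = 2 * (t * L).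
    rewrite fd ?in_itv/= -?/D; [|by lra|by lra].
    by rewrite distrC (_ : _ - _ = 2 * (t * L)) ?ger0_norm//; [lra|ring].
  have := midpoint_dist u gax.
  rewrite dax (_ : f _ = q); last by congr f; field.
  rewrite /cprod da// dx// (metric_sym q u); lra.
have ytri t : 0 < t <= t0 ->
    2 * cprod q (y_ (t / 2)) (a_ (t / 2)) <= cprod q (y_ t) (a_ (t / 2)).
  move=> tt; have [t1 t2 t3] := tle _ tt.
  have th : 0 < t / 2 <= t0 by case/andP: tt => *; apply/andP; split; lra.
  have := @cprod_scale q (y_ t) (a_ (t / 2)) fy fa 2^-1 1.
  rewrite dy// da// mul1r mulrA (mulrC 2^-1 t) => /(_ _ _ _ _).
  have h1 : geodesic q (y_ t) fy.
    by apply: geodesic_initial gy _; rewrite -/b mulr_ge0 ?(ltW t1)//= ler_piMl.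
  have h2 : geodesic q (a_ (t / 2)) fa.
    apply: geodesic_initial ga _; rewrite ds.
    by have [? _ ->] := tle _ th; rewrite andbT mulr_ge0 ?(ltW L0)// ltW.
  move=> /(_ h1 h2 ltac:(by lra) ltac:(by lra)); rewrite -/(y_ _) -/(a_ _); lra.
have ztri t : 0 < t <= t0 ->
    2 * cprod q (z_ (t / 2)) (a_ (t / 2)) <= cprod q (z_ t) (a_ (t / 2)).
  move=> tt; have [t1 t2 t3] := tle _ tt.
  have th : 0 < t / 2 <= t0 by case/andP: tt => *; apply/andP; split; lra.
  have := @cprod_scale q (z_ t) (a_ (t / 2)) fz fa 2^-1 1.
  rewrite dz// da// mul1r mulrA (mulrC 2^-1 t) => /(_ _ _ _ _).
  have h1 : geodesic q (z_ t) fz.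
    by apply: geodesic_initial gz _; rewrite -/c mulr_ge0 ?(ltW t1)//= ler_piMl.
  have h2 : geodesic q (a_ (t / 2)) fa.
    apply: geodesic_initial ga _; rewrite ds.
    by have [? _ ->] := tle _ th; rewrite andbT mulr_ge0 ?(ltW L0)// ltW.
  move=> /(_ h1 h2 ltac:(by lra) ltac:(by lra)); rewrite -/(z_ _) -/(a_ _); lra.
(* Letting t tend to 0 is replaced by a choice of t with [G t] within [e / 2] of the infimum: then
   [G (t / 2)] cannot be smaller than [G t - e / 2]. The infimum is finite by [cprod_ge]. *)
pose G t := (cprod q (y_ t) (a_ t) + cprod q (z_ t) (a_ t)) / t ^+ 2.
have GE t : 0 < t -> cprod q (y_ t) (a_ t) + cprod q (z_ t) (a_ t) = t ^+ 2 * G t.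
  by move=> tp; rewrite /G mulrC divfK// expf_neq0// gt_eqF.
pose S := [set G t | t in [set t | 0 < t <= t0]].
have iS : has_inf S.
  split; first by exists (G t0), t0 => //=; rewrite t00 lexx.
  exists (- (b * L + c * L)) => _ [t /= tt <-]; have [t1 _ _] := tle _ tt.
  rewrite -(ler_pM2l (_ : 0 < t ^+ 2)) ?exprn_gt0// -GE//.
  have := cprod_ge q (y_ t) (a_ t); have := cprod_ge q (z_ t) (a_ t).
  rewrite dy// dz// da//; lra.
(* Expanding the scalar products, [Q] is exactly the right side minus the left side of the claim. *)
pose Q := L ^+ 2 + b ^+ 2 + c ^+ 2
  + 2 * (cprod q x y + cprod q y z + cprod q x z).
suff : 0 <= Q by rewrite /Q /cprod -/L -/b -/c (metric_sym z x); lra.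
apply/ler_addgt0Pr => e e0.
have [_ [t /= tt <-] Gt] := inf_adherent (divr_gt0 e0 (ltr0n R 2)) iS.
have [t1 t2 t3] := tle _ tt.
have th : 0 < t / 2 <= t0 by case/andP: tt => *; apply/andP; split; lra.
have Gh : inf S <= G (t / 2) by apply: ge_inf; [exact: iS.2|exists (t / 2)].
have sy : cprod q (x_ t) (y_ t) <= t * t * cprod q x y.
  by apply: cprod_scale => //; lra.
have sz : cprod q (x_ t) (z_ t) <= t * t * cprod q x z.
  by apply: cprod_scale => //; lra.
have syz : cprod q (y_ t) (z_ t) <= t * t * cprod q y z.
  by apply: cprod_scale => //; lra.
have oy := opp t (y_ t) tt; have oz := opp t (z_ t) tt.
have Yt := ytri t tt; have Zt := ztri t tt.
have Et := GE t t1; have Eh := GE (t / 2) (proj1 (andP th)).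
(* This is C^2 <= (A + B)^2 <= 2 A^2 + 2 B^2, divided by 4, for the path from [y_ t] to [z_ t]
   through [a_ (t / 2)]. *)
have tri : 0 <= mdist (y_ t) (a_ (t / 2)) ^+ 2 / 2
    + mdist (z_ t) (a_ (t / 2)) ^+ 2 / 2 - mdist (y_ t) (z_ t) ^+ 2 / 4.
  have := metric_triangle (y_ t) (a_ (t / 2)) (z_ t).
  rewrite (metric_sym (a_ _) (z_ t)).
  have := mdist_ge0 (y_ t) (z_ t).
  set A := mdist (y_ t) (a_ _); set B := mdist (z_ t) (a_ _); set C := mdist _ _.
  move=> C0 CAB.
  have : C ^+ 2 <= (A + B) ^+ 2 by rewrite ler_sqr ?nnegrE//; lra.
  have := sqr_ge0 (A - B); lra.
have csym u v : cprod q u v = cprod q v u.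
  by rewrite /cprod (metric_sym u v) addrC (addrC (mdist q u ^+ 2)) addrC.
rewrite (csym (x_ t)) in sy; rewrite (csym (x_ t)) in sz.
(* Each reflexivity proof gets one side unfolded, which ties the scalar products to the squared
   distances of [tri] by linear equations. *)
move: tri (erefl (cprod q (y_ t) (a_ (t / 2)))) (erefl (cprod q (z_ t) (a_ (t / 2))))
  (erefl (cprod q (y_ t) (z_ t))).
rewrite {2}/cprod {3}/cprod {4}/cprod dy// dz// da// => tri E1 E2 E3.
have t2p : 0 < t ^+ 2 by rewrite exprn_gt0.
rewrite -(ler_pM2l t2p) mulr0 /Q.
have : t ^+ 2 * (G t - e / 2) <= t ^+ 2 * G (t / 2) by rewrite ler_pM2l//; lra.
lra.
Qed.

(** Move [w] slightly along a geodesic towards [x], apply the interior case and let the displacement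
    tend to 0. If [w = x] there is no interior point, and the triangle inequality suffices. *)
Lemma four_point w x y z :
  mdist x y ^+ 2 + mdist y z ^+ 2 + mdist z x ^+ 2 <=
  3 * (mdist w x ^+ 2 + mdist w y ^+ 2 + mdist w z ^+ 2).
Proof.
have [/eqP wx|wx] := eqVneq (mdist w x) 0.
  have {wx} -> : w = x by apply: mdist_positivity; exact/eqP.
  rewrite (metric_sym z x) mdistxx.
  have : mdist y z ^+ 2 <= (mdist x y + mdist x z) ^+ 2.
    rewrite ler_sqr ?nnegrE ?addr_ge0 ?mdist_ge0// (metric_sym x y).
    exact: metric_triangle.
  have := sqr_ge0 (mdist x y - mdist x z); lra.
have D0 : 0 < mdist w x by rewrite lt_def wx mdist_ge0.
have [f gf] := gT w x.
set a := mdist w x; set b := mdist w y; set c := mdist w z.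
have a0 : 0 <= a by exact: mdist_ge0.
have b0 : 0 <= b by exact: mdist_ge0.
have c0 : 0 <= c by exact: mdist_ge0.
(* For [s <= 1], each squared distance from [f s] exceeds the one from [w] by at most s (2 d + 1);
   three times the sum of these errors is [s * C]. *)
pose C := 3 * (2 * (a + b + c) + 3).
have C0 : 0 < C by rewrite /C; lra.
apply/ler_addgt0Pr => e e0.
pose s := Num.min (Num.min 1 (mdist w x / 2)) (e / C).
have s0 : 0 < s by rewrite !lt_min ltr01 !divr_gt0.
have [s1 sD se] : [/\ s <= 1, s < mdist w x & s * C <= e].
  have /andP[/andP[s1 s2] s3] : (s <= 1) && (s <= mdist w x / 2) && (s <= e / C).
    by rewrite -!le_min.
  split => //; last by rewrite -ler_pdivlMr.
  by apply: (le_lt_trans s2); lra.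
have sD' : 0 < s < mdist w x by rewrite s0.
apply: (le_trans (four_point_interior y z gf sD')).
have ds : mdist (f s) w = s.
  by rewrite metric_sym (geodesic_dist0 gf)// !ltW.
have near u : mdist (f s) u ^+ 2 <= mdist w u ^+ 2 + s * (2 * mdist w u + 1).
  have d0 := mdist_ge0 w u.
  apply: (@le_trans _ _ ((s + mdist w u) ^+ 2)).
    rewrite ler_sqr ?nnegrE ?addr_ge0 ?(ltW s0) ?mdist_ge0//.
    by rewrite -[X in X + _]ds; exact: metric_triangle.
  have : s * s <= s * 1 by rewrite ler_pM2l.
  lra.
have := near x; have := near y; have := near z; rewrite -/a -/b -/c.
rewrite /C in se; lra.
Qed.

End NonnegCurved.

(** * Subsequences and maximal self-stable families *)

Lemma increasing_seq_ge (f : nat -> nat) n : increasing_seq f -> (n <= f n)%N.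
Proof.
move=> /increasing_seqP incf; elim: n => // n IH.
by apply: leq_ltn_trans IH _; exact: incf.
Qed.

(** Monotonicity of [k] is not assumed, so that indices obtained by choice qualify as well. *)
Lemma cvg_comp_ge (T : topologicalType) (u : nat -> T) (k : nat -> nat) (l : T) :
  (forall n, (n <= k n)%N) -> u @ \oo --> l -> (fun n => u (k n)) @ \oo --> l.
Proof.
move=> kn ul; apply: (@cvg_comp _ _ _ k u \oo \oo) => //.
move=> A [N _ NA]; exists N => // n /= Nn; apply: NA => /=.
exact: leq_trans Nn (kn n).
Qed.

(** Subsequences are extracted for one index after another; each refinement keeps the limits already
    obtained. *)
Lemma bolzano_weierstrass_fin (R : realType) (I : finType) (u : I -> nat -> R) :
  (forall i, bounded_fun (u i)) ->
  exists2 f : nat -> nat, increasing_seq f & forall i, cvgn (fun n => u i (f n)).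
Proof.
move=> bu.
suff [f incf fu] : exists2 f : nat -> nat, increasing_seq f &
    forall i, i \in enum I -> cvgn (fun n => u i (f n)).
  by exists f => // i; apply: fu; rewrite mem_enum.
elim: (enum I) => [|i s [f incf fu]]; first by exists id.
have bf : bounded_fun (fun n => u i (f n)).
  by case: (bu i) => M [Mr Mu]; exists M; split => // x /Mu {}Mu n _; exact: Mu.
have [g incg gu] := bolzano_weierstrass bf.
exists (f \o g) => [m n /=|j]; first by rewrite -(incg m n); exact: incf.
rewrite inE => /orP[/eqP ->//|/fu/cvg_ex[l ul]].
by apply/cvg_ex; exists l; exact: cvg_comp_ge (fun n => increasing_seq_ge n incg) ul.
Qed.

Lemma pretangent_family_exists (R : realType) (X : metricType R) (p : X)
    (r : nat -> R) (F0 : set (nat -> X)) :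
  self_stable r F0 -> F0 (fun=> p) ->
  exists2 F, pretangent_family p r F & F0 `<=` F.
Proof.
move=> sF0 F0p.
(* Joining [F0] inside the predicate, rather than asking that A contain [F0], makes the empty chain
   admissible for Zorn's lemma. *)
pose P : set (set (nat -> X)) := [set A | self_stable r (A `|` F0)].
have [|A [PA maxA]] := @Zorn_bigcup _ P.
  move=> C CP Ctot x y.
  move=> [[A CA Ax]|F0x] [[B CB By]|F0y].
  - have [AB|BA] := Ctot _ _ CA CB.
    + by apply: (CP _ CB); left => //; exact: AB.
    + by apply: (CP _ CA); left => //; exact: BA.
  - by apply: (CP _ CA); [left|right].
  - by apply: (CP _ CB); [right|left].
  - exact: sF0.
exists (A `|` F0); last by move=> x; right.
split; last by right.
split => // z nz; apply: contrapT => nex.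
have st x : (A `|` F0) x -> mutually_stable r x z.
  by move=> Ax; apply: contrapT => nst; apply: nex; exists x.
have sym x y : mutually_stable r x y -> mutually_stable r y x.
  rewrite /mutually_stable.
  by under [X in _ -> cvgn X]eq_fun do rewrite metric_sym.
apply: (maxA (A `|` [set z])).
  split=> [x|/(_ z) Az]; first by left.
  by apply: nz; left; apply: Az; right.
have zz : mutually_stable r z z.
  rewrite /mutually_stable; under eq_fun do rewrite mdistxx mul0r.
  exact: is_cvg_cst.
move=> x y.
have split_or w : (A `|` [set z] `|` F0) w -> (A `|` F0) w \/ w = z.
  by case=> [[|]|]; [left; left|right|left; right].
move=> /split_or[Ax|->] /split_or[Ay|->] //.
- exact: PA.
- exact: st.
- exact/sym/st.
Qed.

(** The rescaled distances are at most 2 and there are finitely many pairs, so one subsequence makes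
    them all converge; the resulting self-stable family is then enlarged to a maximal one. *)
Lemma pretangent_family_subsequence (R : realType) (X : metricType R) (p : X)
    (r : nat -> R) (J : finType) (P : J -> nat -> X) :
  normalizing r -> (forall j n, mdist (P j n) p <= r n) ->
  exists f F, [/\ increasing_seq f, normalizing (r \o f),
    pretangent_family p (r \o f) F & forall j, F (P j \o f)].
Proof.
move=> [r0 rc] Pr.
(* The extra index [None] adjoins the constant sequence at [p]. *)
pose Q (j : option J) n := if j is Some j then P j n else p.
have Qr j n : mdist (Q j n) p <= r n.
  by case: j => [j|] /=; rewrite ?mdistxx// ltW.
pose u (k : option J * option J) n := mdist (Q k.1 n) (Q k.2 n) / r n.
have [k|f incf fu] := @bolzano_weierstrass_fin R _ u.
  exists 2; split; first exact: realn.
  move=> x x2 n _; apply: le_trans (ltW x2).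
  rewrite /u ger0_norm ?divr_ge0 ?mdist_ge0 ?(ltW (r0 n))//.
  rewrite ler_pdivrMr//; have := metric_triangle (Q k.1 n) p (Q k.2 n).
  rewrite (metric_sym p); have := Qr k.1 n; have := Qr k.2 n; lra.
have nf : normalizing (r \o f).
  by split=> [n|]; [exact: r0|exact: cvg_comp_ge (fun n => increasing_seq_ge n incf) rc].
have [||F pF QF] := @pretangent_family_exists R X p (r \o f)
    [set x | exists j, x = Q j \o f].
- by move=> _ _ [i ->] [j ->]; exact: (fu (i, j)).
- by exists None.
exists f, F; split => // j; apply: QF; by exists (Some j).
Qed.

Lemma cvg_dtilde (R : realType) (X : metricType R) (p : X) (r : nat -> R)
    (F : set (nat -> X)) (x y : nat -> X) :
  pretangent_family p r F -> F x -> F y ->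
  mdist (x n) (y n) / r n @[n --> \oo] --> dtilde r x y.
Proof. by move=> [[sF _] _] Fx Fy; exact: sF. Qed.

(** * From pretangent spaces back to sequences *)

Section PretangentPoints.
Context (R : realType) (X : metricType R) (p : X) (r : nat -> R).
Context (F : set (nat -> X)) (hr : normalizing r) (hF : pretangent_family p r F).

Lemma pretangent_dtilde_four_point w x y z :
  geodesic_space (pretangent hr hF) -> nonneg_curved (pretangent hr hF) ->
  F w -> F x -> F y -> F z ->
  dtilde r x y ^+ 2 + dtilde r y z ^+ 2 + dtilde r z x ^+ 2 <=
  3 * (dtilde r w x ^+ 2 + dtilde r w y ^+ 2 + dtilde r w z ^+ 2).
Proof.
move=> gT cT Fw Fx Fy Fz.
pose cls u (Fu : F u) : pretangent hr hF :=
  (\pi_(pretangent hr hF) (SigSub (mem_set Fu)))%qT.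
have := four_point gT cT (cls w Fw) (cls x Fx) (cls y Fy) (cls z Fz).
by rewrite !mdist_pretangent.
Qed.

Lemma pretangent_dtilde_midpoint x y :
  geodesic_space (pretangent hr hF) -> F x -> F y ->
  exists z, [/\ F z, dtilde r x z = dtilde r x y / 2 &
    dtilde r y z = dtilde r x y / 2].
Proof.
move=> gT Fx Fy.
pose cls u (Fu : F u) : pretangent hr hF :=
  (\pi_(pretangent hr hF) (SigSub (mem_set Fu)))%qT.
have [g gg] := gT (cls x Fx) (cls y Fy).
have d0 : 0 <= mdist (cls x Fx) (cls y Fy) by exact: mdist_ge0.
have hd : 0 <= mdist (cls x Fx) (cls y Fy) / 2 <= mdist (cls x Fx) (cls y Fy).
  by apply/andP; split; lra.
have := geodesic_dist0 gg hd; have := geodesic_dist1 gg hd.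
(* A representative of the midpoint class is a sequence of [F], and [dtilde] computes its
   distances. *)
set m := g _; rewrite -[m]reprK (metric_sym _ (cls y Fy)) !mdist_pretangent /=.
move=> e1 e0; exists (val (repr m)); split; [exact: set_valP|done|].
by rewrite e1; lra.
Qed.

End PretangentPoints.

(** * Blow-up arguments at [p] *)

Section InfinitesimalGeometry.
Context (R : realType) (X : metricType R) (p : X).

Lemma cvg_mdist (x : nat -> X) : x @ \oo --> p <-> mdist (x n) p @[n --> \oo] --> 0.
Proof.
split=> [/metricType_numDomainType.cvgrPdist_lt xp|/cvgrPdist_lt xp].
  apply/cvgrPdist_lt => e /xp; apply: filterS => n.
  by rewrite sub0r normrN ger0_norm ?mdist_ge0// metric_sym.
apply/metricType_numDomainType.cvgrPdist_lt => e /xp; apply: filterS => n.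
by rewrite sub0r normrN ger0_norm ?mdist_ge0// metric_sym.
Qed.

Lemma A2_lower_bound :
  (forall (r : nat -> R) (hr : normalizing r)
      (F : set (nat -> X)) (hF : pretangent_family p r F),
    geodesic_space (pretangent hr hF) /\ nonneg_curved (pretangent hr hF)) ->
  forall e, 0 < e -> exists2 d, 0 < d & forall w x y z,
    mdist w p < d -> mdist x p < d -> mdist y p < d -> mdist z p < d ->
    - e <= A2 p w x y z.
Proof.
move=> gc e e0; apply: contrapT => nd.
have /choice[q qP] : forall n : nat, exists q : 'I_4 -> X,
    (forall j, mdist (q j) p < n.+1%:R^-1) /\
    A2 p (q 0) (q 1) (q 2) (q 3) < - e.
  move=> n; apply: contrapT => nq; apply: nd.
  exists n.+1%:R^-1; first by rewrite invr_gt0.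
  move=> w x y z wd xd yd zd; rewrite leNgt; apply/negP => Ae; apply: nq.
  exists (fun j : 'I_4 => nth p [:: w; x; y; z] j); split => //.
  by case=> [[|[|[|[|]]]]].
(* This scale is the denominator in [A2], so [A2] is an expression in the rescaled distances
   alone. *)
pose r n := Num.max (Num.max (Num.max (mdist (q n 0) p) (mdist (q n 1) p))
  (mdist (q n 2) p)) (mdist (q n 3) p).
have qr j n : mdist (q n j) p <= r n.
  rewrite /r !le_max; case: j => [[|[|[|[|//]]]]] j4.
  - by rewrite (_ : Ordinal j4 = 0) ?lexx//; exact: val_inj.
  - by rewrite (_ : Ordinal j4 = 1) ?lexx ?orbT//; exact: val_inj.
  - by rewrite (_ : Ordinal j4 = 2) ?lexx ?orbT//; exact: val_inj.
  - by rewrite (_ : Ordinal j4 = 3) ?lexx ?orbT//; exact: val_inj.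
(* At (p, p, p, p) the value of [A2] is 0, which does not violate the bound; hence the scale [r n]
   is positive. *)
have A2E n : (q n 0, q n 1, q n 2, q n 3) == (p, p, p, p) = false.
  apply/negbTE/negP => qp; have [_] := qP n.
  by rewrite /A2 qp oppr_gt0 ltNge (ltW e0).
have r0 n : 0 < r n.
  rewrite lt_def (le_trans (mdist_ge0 _ _) (qr 0 n)) andbT.
  apply/negP => /eqP rn0; have := A2E n.
  have z j : q n j = p.
    apply: mdist_positivity; apply/eqP; rewrite eq_le mdist_ge0 andbT -rn0.
    exact: qr.
  by rewrite !z eqxx.
have hr : normalizing r.
  split => //; apply: (@squeeze_cvgr _ _ _ _ (fun=> 0) (fun n => n.+1%:R^-1)).
  - near=> n; rewrite (ltW (r0 n)) /= !ge_max.
    by have [qn _] := qP n; rewrite !(ltW (qn _)).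
  - exact: cvg_cst.
  - exact: cvg_harmonic.
have [f [F [incf hrf pF Fq]]] :=
  pretangent_family_subsequence (P := fun j n => q n j) hr qr.
have [gT cT] := gc _ hrf _ pF.
pose D i j := dtilde (r \o f) (fun n => q (f n) i) (fun n => q (f n) j).
have D4 : D 1 2 ^+ 2 + D 2 3 ^+ 2 + D 3 1 ^+ 2
    <= 3 * (D 0 1 ^+ 2 + D 0 2 ^+ 2 + D 0 3 ^+ 2).
  exact: pretangent_dtilde_four_point gT cT (Fq 0) (Fq 1) (Fq 2) (Fq 3).
pose u i j n : R := mdist (q (f n) i) (q (f n) j) / r (f n).
have cu2 i j : u i j n * u i j n @[n --> \oo] --> D i j * D i j.
  by apply: cvgM; exact: cvg_dtilde pF (Fq i) (Fq j).
have lim : (u 0 1 n * u 0 1 n + u 0 2 n * u 0 2 n + u 0 3 n * u 0 3 n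
   - 1 / 3 * (u 1 2 n * u 1 2 n + u 2 3 n * u 2 3 n + u 3 1 n * u 3 1 n))
   @[n --> \oo] --> D 0 1 * D 0 1 + D 0 2 * D 0 2 + D 0 3 * D 0 3
   - 1 / 3 * (D 1 2 * D 1 2 + D 2 3 * D 2 3 + D 3 1 * D 3 1).
  apply: cvgB; first by apply: cvgD; [apply: cvgD|]; exact: cu2.
  by apply: cvgM; [exact: cvg_cst|apply: cvgD; [apply: cvgD|]; exact: cu2].
(* Every term is at most [- e], hence so is the limit, whereas [D4] makes the limit nonnegative. *)
have : forall n, (u 0 1 n * u 0 1 n + u 0 2 n * u 0 2 n + u 0 3 n * u 0 3 n
   - 1 / 3 * (u 1 2 n * u 1 2 n + u 2 3 n * u 2 3 n + u 3 1 n * u 3 1 n)) <= - e.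
  move=> n; have [_ /ltW] := qP (f n); rewrite /A2 A2E -/(r (f n)) /u.
  apply: le_trans; rewrite le_eqVlt; apply/orP; left; apply/eqP.
  by have rn := r0 (f n); field; rewrite gt_eqF.
move=> /(@nearW _ \oo)/(limr_le (cvgP _ lim)).
rewrite (cvg_lim _ lim)//.
rewrite -!expr2; lra.
Unshelve. all: by end_near.
Qed.

(** Each [z n] minimizes the larger of the two defects up to 1/(n+1). If these near-minimal defects
    stayed away from 0 along some indices, a midpoint in a pretangent space would supply better
    competitors. *)
Lemma geodesic_pretangent_midpoint_convex :
  (forall (r : nat -> R) (hr : normalizing r)
      (F : set (nat -> X)) (hF : pretangent_family p r F),
    geodesic_space (pretangent hr hF)) ->
  midpoint_convex_at p.
Proof.
move=> gT x y xp yp.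
pose e n z := Num.max `|mdist (x n) z - mdist (x n) (y n) / 2|
   `|mdist (y n) z - mdist (x n) (y n) / 2| / delta p (x n) (y n).
have delta_ge0 a b : 0 <= delta p a b by rewrite le_max mdist_ge0.
have e_ge0 n z : 0 <= e n z by rewrite divr_ge0// le_max normr_ge0.
have /choice[z zP] : forall n, exists z,
    (x n == p -> y n == p -> z = p) /\ forall z', e n z <= e n z' + n.+1%:R^-1.
  (* When both points equal [p], the value [p] is forced by the convention for the quotients; [e]
     itself is then 0, a quotient by 0 being 0. *)
  move=> n; have [/andP[xn yn]|nxy] := boolP ((x n == p) && (y n == p)).
    exists p; split => // z'; rewrite /e /delta (eqP xn) (eqP yn) mdistxx !maxxx.
    by rewrite invr0 mulr0 mulr0 add0r invr_ge0.
  have iS : has_inf [set e n z | z in setT].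
    by split; [exists (e n p), p|exists 0 => _ [z _ <-]].
  have [|_ [z _ <-] ez] := inf_adherent (_ : 0 < n.+1%:R^-1) iS.
    by rewrite invr_gt0.
  exists z; split; first by move=> xn yn; move: nxy; rewrite xn yn.
  move=> z'; apply: (le_trans (ltW ez)); rewrite lerD2r; apply: ge_inf.
    exact: iS.2.
  by exists z'.
have ez0 : e n (z n) @[n --> \oo] --> 0.
  apply: contrapT => ne.
  have [h h0 hP] : exists2 h, 0 < h & forall N, exists2 n, (N <= n)%N & h <= e n (z n).
    apply: contrapT => nh; apply: ne; apply/cvgrPdist_lt => h h0.
    apply: contrapT => nn; apply: nh; exists h => // N.
    apply: contrapT => nN; apply: nn; exists N => // n /= Nn.
    rewrite sub0r normrN ger0_norm// ltNge; apply/negP => hn.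
    by apply: nN; exists n.
  have /choice[k kP] : forall N, exists n, (N <= n)%N /\ h <= e n (z n).
    by move=> N; have [n] := hP N; exists n.
  pose r n := delta p (x (k n)) (y (k n)).
  have r0 n : 0 < r n.
    rewrite lt_def delta_ge0 andbT; apply/negP => /eqP rn0.
    have [_] := kP n; rewrite /e -/(r n) rn0 invr0 mulr0 leNgt h0//.
  have rc : delta p (x n) (y n) @[n --> \oo] --> 0.
    apply: (@squeeze_cvgr _ _ _ _ (fun=> 0) (fun n => mdist (x n) p + mdist (y n) p)).
    - near=> n; rewrite delta_ge0 /= ge_max lerDl lerDr !mdist_ge0//.
    - exact: cvg_cst.
    - rewrite -[X in _ --> X]addr0; apply: cvgD; exact/cvg_mdist.
  have hr : normalizing r.
    by split => //; apply: cvg_comp_ge rc => n; have [] := kP n.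
  have [|f [F [incf hrf pF FP]]] := @pretangent_family_subsequence R X p r bool
      (fun b n => if b then x (k n) else y (k n)) hr.
    by move=> [] n; rewrite /r /delta le_max lexx ?orbT.
  have Fx := FP true; have Fy := FP false.
  have [z' [Fz' dx dy]] := pretangent_dtilde_midpoint (gT _ hrf _ pF) Fx Fy.
  have cx := cvg_dtilde pF Fx Fz'; have cy := cvg_dtilde pF Fy Fz'.
  have cxy := cvg_dtilde pF Fx Fy.
  rewrite dx in cx; rewrite dy in cy.
  set D := dtilde _ _ _ in cx cy cxy.
  (* The competitor has defect at most h/4 + h/8, hence at most h/2; near-minimality adds less than
     h/4, and the total stays below h. *)
  have h4 : 0 < h / 4 by lra.
  near \oo => n.
  have hx : `|D / 2 - mdist (x (k (f n))) (z' n) / r (f n)| < h / 4.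
    by near: n; exact: (cvgr_dist_lt _ _ cx _ h4).
  have hy : `|D / 2 - mdist (y (k (f n))) (z' n) / r (f n)| < h / 4.
    by near: n; exact: (cvgr_dist_lt _ _ cy _ h4).
  have hxy : `|D - mdist (x (k (f n))) (y (k (f n))) / r (f n)| < h / 4.
    by near: n; exact: (cvgr_dist_lt _ _ cxy _ h4).
  have hn : n.+1%:R^-1 < h / 4.
    by near: n; exact: (near_infty_natSinv_lt (PosNum h4)).
  have [kn hk] := kP (f n).
  (* The sequence [z'] lives on the subsequence: its n-th term competes at the original index
     [k (f n)], which is at least n. *)
  have [_ /(_ (z' n)) ez] := zP (k (f n)).
  have rn := r0 (f n).
  have e1 : e (k (f n)) (z' n) <= h / 2.
    rewrite /e -/(r (f n)) ler_pdivrMr// ge_max.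
    have nrm a b : `|a - b| = `|a / r (f n) - b / r (f n)| * r (f n).
      by rewrite -mulrBl normrM (gtr0_norm (_ : 0 < (r (f n))^-1)) ?invr_gt0// divfK// gt_eqF.
    rewrite (nrm (mdist (x _) _)) (nrm (mdist (y _) _)) !ler_pM2r// !(mulrAC _ 2^-1).
    move: hx hy hxy; rewrite !ltr_norml !ler_norml.
    by move=> /andP[? ?] /andP[? ?] /andP[? ?]; apply/andP; split; apply/andP; split; lra.
  have e2 : (k (f n)).+1%:R^-1 <= n.+1%:R^-1 :> R.
    rewrite lef_pV2 ?posrE// ler_nat ltnS.
    exact: leq_trans (increasing_seq_ge _ incf) kn.
  move: (le_lt_trans (le_trans hk ez) (ler_ltD e1 (le_lt_trans e2 hn))); lra.
have def a : (a = x \/ a = y) ->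
    midpoint_defect p (a n) (x n) (y n) (z n) @[n --> \oo] --> 0%E.
  move=> ax.
  (* The value [+oo] never occurs, since [z n = p] whenever [x n = y n = p]; the defect is therefore
     a real sequence, dominated by [e n (z n)]. *)
  pose m n := if (x n == p) && (y n == p) then 0 else
    `|mdist (a n) (z n) - mdist (x n) (y n) / 2| / delta p (x n) (y n).
  have -> : (fun n => midpoint_defect p (a n) (x n) (y n) (z n)) = EFin \o m.
    apply/funext => n; rewrite /midpoint_defect /m /=.
    by case: ifPn => // /andP[xn yn]; have [-> //] := zP n; rewrite eqxx.
  apply: cvg_EFin; first by near=> n.
  apply: (@squeeze_cvgr _ _ _ _ (fun=> 0) (fun n => e n (z n))) => //.
  - near=> n; rewrite /m /=; case: ((x n == p) && (y n == p)); first by rewrite lexx e_ge0.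
    rewrite divr_ge0//= /e ler_wpM2r ?invr_ge0// le_max.
    by case: ax => ->; rewrite lexx ?orbT.
  - exact: cvg_cst.
by exists z; split; apply: def; [left|right].
Unshelve. all: by end_near.
Qed.

End InfinitesimalGeometry.

Theorem mainTheorem4 (R : realType) (X : metricType R) (p : X) :
  (forall (r : nat -> R) (hr : normalizing r)
      (F : set (nat -> X)) (hF : pretangent_family p r F),
    [/\ complete_space (pretangent hr hF),
        geodesic_space (pretangent hr hF) &
        nonneg_curved (pretangent hr hF)]) ->
  midpoint_convex_at p /\
  (0 <= limf_einf (fun q : X * X * X * X =>
          (A2 p q.1.1.1 q.1.1.2 q.1.2 q.2)%:E) (nbhs (p, p, p, p)))%E.
Proof.
move=> hT; split.
  by apply: geodesic_pretangent_midpoint_convex => r hr F hF; case: (hT r hr F hF).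
have gc r (hr : normalizing r) F (hF : pretangent_family p r F) :
    geodesic_space (pretangent hr hF) /\ nonneg_curved (pretangent hr hF).
  by case: (hT r hr F hF).
apply/lee_addgt0Pr => e e0.
have [d d0 dP] := A2_lower_bound gc e0.
(* The lower limit is a supremum of infima over neighbourhoods; the product ball of radius [d]
   already gives an infimum of at least [- e]. *)
rewrite -leeBlDr// sub0e limf_einfE.
apply: le_trans (ereal_sup_ubound _); last first.
  by exists (ball (p, p, p, p) d) => //; exact: nbhsx_ballx.
apply: le_ereal_inf_tmp => _ [[[[w x] y] z] [[[bw bx] by_] bz] <-].
rewrite -EFinN lee_fin; move: bw bx by_ bz; rewrite !ballEmdist /= => *.
by apply: dP; rewrite metric_sym.
Qed.
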